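(* Let $S$ be a numerical semigroup, let $a\in S$ be nonzero, let $m$ be a positive integer, and suppose $\mathrm{Ap}(S;a)=\{0\}\cup\{\beta+i\delta : 1\le i\le a-1\}$ for some integers $\beta\ge 0$ and $\delta>0$. (When $a\ge3$, $\beta$ and $\delta$ are uniquely determined. For $a=1$, take $\beta=0$ and $\delta=1$. For $a=2$, take $\beta=0$ and $\delta$ odd.) Then $\mathrm{H}(S)$ is equidistributed modulo $m$ if and only if $\gcd(a\delta,m)=1$ and one of the following occurs: (1) $a\equiv1\pmod m$; or (2) $a\equiv2\pmod m$ and $\beta+\delta\equiv1\pmod m$; or (3) $\delta\equiv1\pmod m$ and $\beta\equiv0\pmod m$; or (4) $\delta\equiv-1\pmod m$ and $\beta\equiv a\pmod m$.
   Context: A numerical semigroup is a submonoid $S$ of $(\mathbb{N}_0,+)$ with finite complement; $\mathrm{H}(S)=\mathbb{N}_0\setminus S$ is its set of gaps. For nonzero $a\in S$, the Apéry set is $\mathrm{Ap}(S;a)=\{s\in S: s-a\notin S\}$; it has exactly $a$ elements. A finite (multi)set of integers is equidistributed modulo $m$ if it contains the same number of elements in each congruence class modulo $m$. ''One of the following'' is meant inclusively (at least one).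
   Formalization: The case S = N_0 with gcd(a,m) > 1 is excluded: there H(S) is empty, hence trivially equidistributed, while gcd(aδ,m) ≠ 1 (e.g. S = N_0, a = m = 2, β = 0, δ = 1), so the claim as stated fails. *)

(* Defs.v *)
From mathcomp Require Import all_boot.
From mathcomp Require Import boolp classical_sets functions cardinality.

Set Implicit Arguments.
Unset Strict Implicit.
Unset Printing Implicit Defensive.

Local Open Scope classical_set_scope.
Local Open Scope card_scope.

Definition gaps (S : set nat) : set nat := ~` S.

Record numerical_semigroup (S : set nat) : Prop := NumericalSemigroup {
  numsg0 : S 0;
  numsgD : forall x y, S x -> S y -> S (x + y);
  numsg_finite_gaps : finite_set (gaps S) }.

(* Subtraction on nat is truncated: when s < a the integer s - a is negative,
   hence not in S, which is what the guard [a <= s] expresses. *)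
Definition apery (S : set nat) (a : nat) : set nat :=
  [set s | S s /\ ~ (a <= s /\ S (s - a))].

(* Only meant for finite A, where #= says that the two residue classes of A
   have the same number of elements. *)
Definition equidistributed_mod (m : nat) (A : set nat) : Prop :=
  forall r1 r2 : nat,
    (A `&` [set x | x = r1 %[mod m]]) #= (A `&` [set x | x = r2 %[mod m]]).

(* Main.v *)
(* A natural number n has n - a outside S exactly when n is a gap or lies in
   Ap(S; a), and also exactly when n is a translate by a of a gap or n < a.
   Hence, as multisets, (H + a) + {0, ..., a - 1} = H + Ap(S; a).  If H is
   equidistributed modulo m, then H and H + a have the same residues, so that
   {beta + i delta : 1 <= i < a} and {1, ..., a - 1} agree modulo m; the converse
   holds when a is prime to m.  Two such progressions agree, once full periods
   are removed, only in the four listed cases.  When d = gcd(a, m) > 1, adding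
   up the multiples of d on both sides, and then all the elements, evaluates the
   number h of multiples of d in H and the size of H in terms of a, beta, delta;
   equidistribution gives |H| = d h, which is only possible if H is empty. *)
Require Import Defs.
From mathcomp Require Import all_boot zify.
From mathcomp Require Import boolp classical_sets functions cardinality.

Local Open Scope classical_set_scope.

(** * Arithmetic progressions modulo [m] *)

Definition residues (m : nat) (s : seq nat) : seq nat := [seq x %% m | x <- s].

Definition ap (beta delta k n : nat) : seq nat :=
  [seq beta + i * delta | i <- iota k n].

Lemma residues_cat m s1 s2 :
  residues m (s1 ++ s2) = residues m s1 ++ residues m s2.
Proof. exact: map_cat. Qed.

Lemma ap01 k n : ap 0 1 k n = iota k n.
Proof. by rewrite -[RHS]map_id; apply: eq_map => i; rewrite /= muln1. Qed.

Lemma ap_add beta delta k n1 n2 :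
  ap beta delta k (n1 + n2) = ap beta delta k n1 ++ ap beta delta (k + n1) n2.
Proof. by rewrite /ap iotaD map_cat. Qed.

Lemma uniq_residues_ap m beta delta k n : coprime delta m -> n <= m ->
  uniq (residues m (ap beta delta k n)).
Proof.
move=> co le_nm; rewrite /residues /ap -map_comp map_inj_in_uniq ?iota_uniq //.
have main i j : i \in iota k n -> j \in iota k n -> i <= j ->
    (beta + i * delta) = (beta + j * delta) %[mod m] -> i = j.
  rewrite !mem_iota => hi hj le_ij /esym/eqP.
  rewrite eqn_modDl eqn_mod_dvd ?leq_mul2r ?le_ij ?orbT // -mulnBl.
  rewrite Gauss_dvdl 1?coprime_sym // => /dvdn_leq.
  by case: (ltngtP i j) le_ij => //; lia.
move=> i j hi hj /= eq_ij; case: (leqP i j) => [|/ltnW] le_ij.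
  exact: main.
by apply/esym; apply: main.
Qed.

Lemma perm_residues_ap_full m beta delta k : 0 < m -> coprime delta m ->
  perm_eq (residues m (ap beta delta k m)) (iota 0 m).
Proof.
move=> m_gt0 co; apply: uniq_perm; rewrite ?iota_uniq ?uniq_residues_ap //.
apply: (uniq_min_size _ _ _).2;
  rewrite ?uniq_residues_ap ?size_map ?size_iota //.
by move=> _ /mapP[x _ ->]; rewrite mem_iota /= ltn_pmod.
Qed.

(** With [delta] and [delta'] prime to [m], any [m] consecutive terms form a complete residue
    system, so the [q] full periods cancel. *)
Lemma perm_residues_ap_shift m beta delta beta' delta' k q r :
    0 < m -> coprime delta m -> coprime delta' m ->
  perm_eq (residues m (ap beta delta k (r + q * m)))
          (residues m (ap beta' delta' k (r + q * m))) =
  perm_eq (residues m (ap beta delta k r)) (residues m (ap beta' delta' k r)).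
Proof.
move=> m_gt0 co co'; elim: q => [|q IHq]; first by rewrite addn0.
rewrite mulSnr addnA ap_add (ap_add beta') !residues_cat -{}IHq.
set u := residues m (ap beta _ _ m); set v := residues m (ap _ _ _ m).
have uv : perm_eq u v.
  apply: perm_trans (perm_residues_ap_full _ _ _ _ m_gt0 co) _.
  by rewrite perm_sym; apply: perm_residues_ap_full.
have Auv s : perm_eq (s ++ u) (s ++ v) by rewrite perm_cat2l.
by rewrite (permPl (Auv _)) perm_cat2r.
Qed.

(** Modulo g = gcd([delta], [m]) the progression is constant, while the interval contains 1 and 2;
    so g divides 1. *)
Lemma perm_residues_ap_coprime m beta delta n : 1 < n -> 0 < m ->
  perm_eq (residues m (ap beta delta 1 n)) (residues m (iota 1 n)) ->
  coprime delta m.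
Proof.
move=> n_gt1 m_gt0 /perm_mem eqr; apply/eqP; set g := gcdn delta m.
have gm : g %| m by exact: dvdn_gcdr.
have in_class j : 0 < j <= n -> j = beta %[mod g].
  move=> hj; have : j %% m \in residues m (ap beta delta 1 n).
    by rewrite eqr; apply: map_f; rewrite mem_iota; lia.
  case/mapP => _ /mapP[i _ ->] /(congr1 (modn^~ g)).
  rewrite !modn_dvdm // => ->.
  by rewrite -modnDmr -modnMmr (eqP (dvdn_gcdl _ _)) muln0 mod0n addn0.
have /eqP : 2 = 1 %[mod g] by rewrite (in_class 2) ?(in_class 1) //; lia.
by rewrite eqn_mod_dvd // subn1 dvdn1 => /eqP.
Qed.

(* An arithmetic progression has a single element that leaves it under
   translation by its difference, while an interval of length r, with
   2 <= r <= m - 2, has a single one only when the translation is by 1 or -1. *)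
Lemma perm_residues_ap_interval m beta delta r : coprime delta m ->
    1 < r -> r + 2 <= m ->
    perm_eq (residues m (ap beta delta 1 r)) (residues m (iota 1 r)) ->
  (delta = 1 %[mod m] /\ beta = 0 %[mod m]) \/
  (delta + 1 = 0 %[mod m] /\ beta = r + 1 %[mod m]).
Proof.
move=> co r_gt1 r_lem /perm_mem eqr.
have m_gt0 : 0 < m by lia.
have memr x : (x %% m \in residues m (ap beta delta 1 r)) = (0 < x %% m <= r).
  rewrite eqr; apply/mapP/idP => [[y]|hx].
    by rewrite mem_iota => hy ->; rewrite modn_small; lia.
  by exists (x %% m); rewrite ?modn_mod // mem_iota; lia.
(* The class of [x] is that of some term; if this is not the last term, adding [delta] gives the
   next one, again in the interval. *)
have last_ap x : 0 < x <= r -> ~~ (0 < (x + delta) %% m <= r) ->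
    x = beta + r * delta %[mod m].
  move=> hx; rewrite -memr => out.
  have : x %% m \in residues m (ap beta delta 1 r).
    by rewrite memr modn_small; lia.
  case/mapP => _ /mapP[i hi ->] eqx; rewrite mem_iota in hi.
  have [<-|ne_ir] := eqVneq i r; first by [].
  case/negP: out.
  rewrite -modnDml eqx modnDml; apply/mapP; exists (beta + i.+1 * delta).
    by apply: map_f; rewrite mem_iota; lia.
  by congr (_ %% _); lia.
pose d := delta %% m; have d_lt : d < m by rewrite ltn_pmod.
have d_gt0 : 0 < d.
  rewrite lt0n; apply: contraTneq co => d0.
  by rewrite /coprime -gcdn_modl -/d d0 gcd0n; lia.
have last_apd x : 0 < x <= r -> r < x + d <= m -> x = beta + r * delta %[mod m].
  move=> hx hxd; apply: last_ap => //; rewrite -modnDmr -/d.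
  have [lt_m|->] : x + d < m \/ x + d = m by lia.
    by rewrite modn_small //; lia.
  by rewrite modnn.
have [d1|d_ne1] := eqVneq d 1.
  left; have d1' : delta = 1 %[mod m] by rewrite -/d d1 modn_small; lia.
  split=> //; have /eqP := last_apd r ltac:(lia) ltac:(lia).
  rewrite -modnDmr -modnMmr d1' modnMmr modnDmr muln1 -{1}[r]add0n eqn_modDr.
  by move/eqP.
have [dm|d_nem] := eqVneq d m.-1.
  right; have d1' : delta + 1 = 0 %[mod m].
    by rewrite -modnDml -/d dm addn1 prednK // modnn mod0n.
  split=> //; have /eqP := last_apd 1 ltac:(lia) ltac:(lia).
  rewrite -(eqn_modDr r) -addnA -{3}[r]muln1 -mulnDr.
  rewrite -[X in _ == X]modnDmr -modnMmr d1' modnMmr muln0 mod0n addn0.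
  by rewrite addnC => /eqP.
(* Now 2 <= [d] <= [m] - 2, and both [x] and [x.+1] leave the interval under translation by [d];
   truncation makes [x] equal to 1 when [d] >= [r]. *)
pose x := (r - d).+1.
have shift_x : x = x.+1 %[mod m].
  by rewrite (last_apd x) ?(last_apd x.+1) // /x; lia.
by exfalso; move: shift_x; rewrite !modn_small /x; lia.
Qed.

Lemma perm_sub_iota a :
  perm_eq [seq a - i | i <- iota 1 (a - 1)] (iota 1 (a - 1)).
Proof.
apply: uniq_perm; rewrite ?iota_uniq //.
  rewrite map_inj_in_uniq ?iota_uniq // => i j; rewrite !mem_iota; lia.
move=> x; rewrite mem_iota; apply/mapP/idP => [[i]|hx].
  by rewrite mem_iota; lia.
by exists (a - x); rewrite ?mem_iota; lia.
Qed.

(** Write [a - 1] as [r + q * m] and drop the full periods: [r] = 0 and [r] = 1 give the first two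
    cases, 2 <= [r] <= [m] - 2 the last two, while [r] = [m] - 1 > 1 would make [m] divide [a]. *)
Lemma perm_residues_ap_iota m beta delta a : 0 < a -> 0 < m -> coprime a m ->
    (a = 1 -> delta = 1) -> (a = 2 -> beta = 0) ->
  perm_eq (residues m (ap beta delta 1 (a - 1))) (residues m (iota 1 (a - 1)))
  <-> coprime delta m /\
  [\/ a = 1 %[mod m],
      a = 2 %[mod m] /\ beta + delta = 1 %[mod m],
      delta = 1 %[mod m] /\ beta = 0 %[mod m]
    | delta + 1 = 0 %[mod m] /\ beta = a %[mod m] ].
Proof.
move=> a_gt0 m_gt0 co_am a1 a2.
have full_periods q r : a - 1 = r + q * m -> coprime delta m ->
    perm_eq (residues m (ap beta delta 1 (a - 1)))
            (residues m (iota 1 (a - 1))) =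
    perm_eq (residues m (ap beta delta 1 r)) (residues m (iota 1 r)).
  move=> -> co; rewrite -ap01 perm_residues_ap_shift ?ap01 //.
  exact: coprime1n.
have small1 : perm_eq (residues m (ap beta delta 1 1)) (residues m (iota 1 1))
    = (beta + delta == 1 %[mod m]).
  rewrite /= mul1n; apply/idP/eqP => [/perm_mem/(_ (1 %% m))|->//].
  by rewrite !inE eqxx => /eqP.
split=> [eqr|[co]].
  (* For [a] <= 2 there is at most one term and no difference to compare; the normalisations [delta]
     = 1 and [beta] = 0 take over. *)
  have co : coprime delta m.
    have [a_eq1|a_ne1] := eqVneq a 1; first by rewrite (a1 a_eq1) coprime1n.
    have [a_eq2|a_ne2] := eqVneq a 2; last first.
      by apply: (perm_residues_ap_coprime m beta delta (a - 1)) => //; lia.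
    move: eqr; rewrite a_eq2 (_ : 2 - 1 = 1) // small1 (a2 a_eq2).
    move/eqP => delta1.
    by rewrite /coprime -gcdn_modl delta1 gcdn_modl gcd1n.
  split=> //; pose q := (a - 1) %/ m; pose r := (a - 1) %% m.
  have a1E : a - 1 = r + q * m by rewrite addnC -divn_eq.
  have r_lt : r < m by rewrite ltn_pmod.
  have aE : a = q * m + r.+1 by rewrite addnS addnC -a1E subn1 prednK.
  rewrite (full_periods q r) // in eqr.
  have [r0|r_ne0] := eqVneq r 0; first by constructor 1; rewrite aE r0 modnMDl.
  have [r1|r_ne1] := eqVneq r 1.
    constructor 2; rewrite {1}aE r1 modnMDl; split=> //.
    by apply/eqP; rewrite -small1; rewrite r1 in eqr.
  have [rm|r_nem] := eqVneq r.+1 m.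
    have ma : m %| a by rewrite aE rm -mulSnr dvdn_mull.
    move: co_am; rewrite /coprime (gcdn_idPr ma) => /eqP m1.
    by rewrite m1 in r_lt; case: (r) r_ne0 r_lt.
  have r_gt1 : 1 < r by lia.
  have r_lem : r + 2 <= m by lia.
  have [//||[d1 ba]] := perm_residues_ap_interval m beta delta r co r_gt1 r_lem.
    by constructor 3.
  by constructor 4; split=> //; rewrite ba [in RHS]aE modnMDl addn1.
have perm_of_eq s t : residues m s = residues m t ->
  perm_eq (residues m s) (residues m t) by move=> ->.
case=> [a_eq|[a_eq bd]|[d1 b0]|[d1 ba]].
- move/eqP: a_eq; rewrite eqn_mod_dvd // => /dvdnP[q qE].
  by rewrite (full_periods q 0).
- have [->|a_ne1] := eqVneq a 1; first by [].
  move/eqP: a_eq; rewrite eqn_mod_dvd; last by lia.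
  move/dvdnP=> [q qE]; rewrite (full_periods q 1) ?small1 ?bd //; lia.
- apply: perm_of_eq; rewrite /residues /ap -map_comp; apply: eq_map => i /=.
  by rewrite -modnDml b0 mod0n add0n -modnMmr d1 modnMmr muln1.
(* In the last case [beta + i * delta] is congruent to [a - i]: the progression is the interval read
   backwards. *)
apply: perm_trans (perm_map (modn^~ m) (perm_sub_iota a)).
apply: perm_of_eq; rewrite /residues /ap -!map_comp.
apply/eq_in_map => i; rewrite mem_iota => hi /=.
have le_ia : i <= a by clear -hi; lia.
apply/eqP; rewrite -(eqn_modDr i) -addnA -{2}[i]muln1 -mulnDr subnK //.
by rewrite -modnDmr -modnMmr d1 modnMmr muln0 mod0n addn0 ba.
Qed.

(** * Finite gap sets as lists, and their counts by residue class *)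

Lemma perm_eq_count (T : eqType) (s t : seq T) :
  (forall x, count_mem x s = count_mem x t) -> perm_eq s t.
Proof. by move=> eq_st; apply/allP => x _; apply/eqP. Qed.

Lemma card_eq_seq (T : eqType) (s : seq T) :
  uniq s -> ([set` s] #= `I_(size s))%card.
Proof.
elim: s => [_|x s IHs /= /andP[xNs us]].
  by rewrite set_nil II0 card_eq0.
apply/eq_cardSP; exists x; first by rewrite /= mem_head.
rewrite (_ : _ `\ x = [set` s]) ?IHs //; apply/seteqP; split=> y /=.
  by rewrite inE => -[/orP[/eqP|]].
move=> ys; split; first by rewrite inE ys orbT.
by move=> yx; rewrite -yx ys in xNs.
Qed.

Definition balanced (m : nat) (G : seq nat) : Prop :=
  forall r1 r2, count (fun x => x == r1 %[mod m]) G =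
                count (fun x => x == r2 %[mod m]) G.

Lemma equidistributed_mod_balanced (m : nat) (G : seq nat) : uniq G ->
  equidistributed_mod m [set` G] <-> balanced m G.
Proof.
move=> uG.
have card_class r : ([set` G] `&` [set x | x = r %[mod m]] #=
    `I_(count (fun x => x == r %[mod m]) G))%card.
  rewrite -size_filter (_ : _ `&` _ = [set` [seq x <- G | x == r %[mod m]]]).
    by rewrite card_eq_seq // filter_uniq.
  apply/seteqP; split=> x /=; rewrite mem_filter.
    by case=> xG ->; rewrite eqxx.
  by case/andP=> /eqP.
split=> eq_class r1 r2.
  apply/card_eq_II/(card_eq_trans _ (card_class r2)).
  by apply: card_eq_trans (eq_class r1 r2); apply/card_esym/card_class.
apply: card_eq_trans (card_class r1) _.
by rewrite (eq_class r1 r2); apply/card_esym/card_class.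
Qed.

(* Both sides enumerate, without repetition, the natural numbers n such that
   the integer n - a is not in S. *)
Lemma perm_gaps_apery (S : set nat) (a beta delta : nat) (G : seq nat) :
    numerical_semigroup S -> S a -> 0 < a -> 0 < delta -> uniq G ->
    gaps S = [set` G] ->
    apery S a =
      [set 0] `|` [set beta + i * delta | i in [set i | 1 <= i <= a - 1]] ->
  perm_eq ([seq g + a | g <- G] ++ iota 0 a)
          (G ++ 0 :: ap beta delta 1 (a - 1)).
Proof.
move=> [S0 SD _] Sa a_gt0 d_gt0 uG GE apE.
have memG x : x \in G <-> ~ S x.
  by have -> : (~ S x) = [set` G] x by rewrite -GE.
have mem_ap x : x \in 0 :: ap beta delta 1 (a - 1) <-> apery S a x.
  rewrite apE inE; split=> [/orP[/eqP->|/mapP[i]]|[->|[i hi <-]]].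
  - by left.
  - by rewrite mem_iota => hi ->; right; exists i => //=; lia.
  - by rewrite eqxx.
  - by apply/orP; right; apply: map_f; rewrite mem_iota; move: hi => /=; lia.
apply: uniq_perm.
- rewrite cat_uniq iota_uniq map_inj_uniq ?uG; last exact: addIn.
  rewrite andbT /=; apply/hasPn => x; rewrite mem_iota => hx.
  by apply/mapP => -[g _ xE]; lia.
- rewrite cat_uniq uG /=; apply/and3P; split.
  + rewrite -[_ || _]/(has (mem G) (0 :: ap beta delta 1 (a - 1))).
    by apply/hasPn => x /mem_ap[Sx _]; apply/negP => /memG.
  + by apply/mapP => -[i]; rewrite mem_iota => hi; nia.
  + rewrite map_inj_uniq ?iota_uniq // => i j /addnI/eqP.
    by rewrite eqn_pmul2r // => /eqP.
move=> x; rewrite !mem_cat; apply/idP/idP.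
  move=> hx; have notS : ~ (a <= x /\ S (x - a)).
    move=> [le_ax Sxa]; case/orP: hx => [/mapP[g /memG gNS xE]|].
      by apply: gNS; rewrite xE addnK in Sxa.
    by rewrite mem_iota; lia.
  have [Sx|NSx] := pselect (S x); apply/orP; [right|left].
    exact/mem_ap.
  exact/memG.
move=> hx; have notS : ~ (a <= x /\ S (x - a)).
  case/orP: hx => [/memG NSx|/mem_ap[]//] [le_ax Sxa].
  by apply: NSx; rewrite -(subnK le_ax); apply: SD.
apply/orP; have [le_ax|lt_xa] := leqP a x; [left|right].
  apply/mapP; exists (x - a); last by rewrite subnK.
  by apply/memG => Sxa; apply: notS.
by rewrite mem_iota.
Qed.

Lemma count_mem_residues m r G :
  count_mem (r %% m) (residues m G) = count (fun x => x == r %[mod m]) G.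
Proof. by rewrite count_map. Qed.

Lemma perm_residues_count m G H :
  (forall r, count (fun x => x == r %[mod m]) G =
             count (fun x => x == r %[mod m]) H) ->
  perm_eq (residues m G) (residues m H).
Proof.
move=> eqGH; apply/allP => x; rewrite -residues_cat => /mapP[r _ ->].
by rewrite /= !count_mem_residues eqGH.
Qed.

Lemma balanced_shift m a G : 0 < m -> balanced m G ->
  perm_eq (residues m [seq g + a | g <- G]) (residues m G).
Proof.
move=> m_gt0 balG; apply: perm_residues_count => r.
(* In [nat], [r + m.-1 * a] represents the class of r - a. *)
rewrite count_map (balG r (r + m.-1 * a)); apply: eq_count => x /=.
rewrite -(eqn_modDr a x) -addnA -mulSnr prednK //.
by rewrite -(modnDmr r (m * a)) modnMr addn0.
Qed.

(** Class counts are invariant under adding [a], and the classes of [r1 + k * a] exhaust all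
    residues because [a] is invertible modulo [m]. *)
Lemma shift_balanced m a G : 0 < m -> coprime a m ->
  perm_eq (residues m [seq g + a | g <- G]) (residues m G) -> balanced m G.
Proof.
move=> m_gt0 co eqG r1 r2.
pose C r := count (fun x => x == r %[mod m]) G.
have CS r : C (r + a) = C r.
  rewrite /C -count_mem_residues -(permP eqG) count_mem_residues count_map.
  by apply: eq_count => x /=; rewrite eqn_modDr.
have CM k : C (r1 + k * a) = C r1.
  by elim: k => [|k IHk]; rewrite ?addn0 // mulSnr addnA CS.
have : r2 %% m \in residues m (ap r1 a 0 m).
  rewrite (perm_mem (perm_residues_ap_full _ _ _ _ m_gt0 co)).
  by rewrite mem_iota ltn_pmod.
case/mapP => _ /mapP[k _ ->] r2E; rewrite -[LHS](CM k).
by apply: eq_count => x; rewrite r2E.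
Qed.

(** Once the two zeros cancel, each side of the count identity has two terms, so one pair agrees
    exactly when the other does. *)
Lemma perm_residues_cancel m a G t : 0 < a ->
    perm_eq ([seq g + a | g <- G] ++ iota 0 a) (G ++ 0 :: t) ->
  perm_eq (residues m [seq g + a | g <- G]) (residues m G) =
  perm_eq (residues m t) (residues m (iota 1 (a - 1))).
Proof.
case: a => // a _ /(perm_map (modn^~ m)).
rewrite subn1 /= -!/(residues m _) !residues_cat /= => /permP eqGt.
have cancel_count p : count p (residues m [seq g + a.+1 | g <- G]) +
    count p (residues m (iota 1 a)) = count p (residues m G) +
    count p (residues m t).
  by move: (eqGt p); rewrite !count_cat /=; lia.
apply/permP/permP => eqc p; have := cancel_count p.
  by rewrite eqc => /addnI.
by rewrite eqc => /addIn.
Qed.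

(** * Excluding a common divisor of [a] and [m] *)

Lemma perm_dvdn_iota d e : 0 < d ->
  perm_eq [seq i <- iota 1 (e * d - 1) | d %| i]
          [seq j * d | j <- iota 1 (e - 1)].
Proof.
move=> d_gt0; apply: uniq_perm; first by rewrite filter_uniq ?iota_uniq.
  rewrite map_inj_uniq ?iota_uniq // => i j /eqP.
  by rewrite eqn_pmul2r // => /eqP.
move=> x; rewrite mem_filter mem_iota; apply/andP/mapP.
  case=> /dvdnP[j ->] hj; exists j => //; rewrite mem_iota.
  have j_gt0 : 0 < j by case: j hj.
  have : j < e by rewrite -(ltn_pmul2r d_gt0); lia.
  by lia.
case=> j; rewrite mem_iota => hj ->; rewrite dvdn_mull //; split=> //.
have : j * d < e * d by rewrite ltn_pmul2r //; lia.
have : 0 < j * d by rewrite muln_gt0 d_gt0 andbT; lia.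
lia.
Qed.

(** The residues of [G] form [c] copies of 0, ..., [m - 1], each containing m/d multiples of [d]. *)
Lemma count_dvdn_balanced m d G : 0 < m -> d %| m -> balanced m G ->
  count (fun g => d %| g) G * d = size G.
Proof.
move=> m_gt0 dm balG; pose c := count (fun x => x == 0 %[mod m]) G.
have eqG : perm_eq (residues m G) (flatten (nseq c (iota 0 m))).
  apply: perm_eq_count => x; rewrite count_flatten map_nseq sumn_nseq.
  rewrite (count_uniq_mem _ (iota_uniq 0 m)) mem_iota add0n /=.
  have [lt_xm|le_mx] := ltnP x m.
    by rewrite mul1n -{1}(modn_small lt_xm) count_mem_residues /c (balG x 0).
  apply/count_memPn/mapP => -[y _ xE].
  by have := ltn_pmod y m_gt0; rewrite -xE ltnNge le_mx.
have /= <- : count (fun x => d %| x) (residues m G) = count (fun x => d %| x) G.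
  by rewrite count_map; apply: eq_count => x /=; rewrite /dvdn modn_dvdm.
have <- : size (residues m G) = size G by rewrite size_map.
rewrite (permP eqG) (perm_size eqG) size_flatten /shape count_flatten.
rewrite !map_nseq !sumn_nseq size_iota; case/dvdnP: dm => e mE.
have d_gt0 : 0 < d by move: m_gt0; rewrite mE muln_gt0 => /andP[].
have -> : iota 0 m = 0 :: iota 1 (m - 1) by rewrite subn1; case: (m) m_gt0.
rewrite /= dvdn0 -size_filter mE (perm_size (perm_dvdn_iota _ _ d_gt0)).
rewrite size_map size_iota subnKC; last by case: (e) mE m_gt0 => // ->.
by rewrite mulnAC mulnC mulnA.
Qed.

Lemma sumn_ap beta delta n :
  2 * sumn (ap beta delta 1 n) = n * (2 * beta + n.+1 * delta).
Proof.
elim: n => // n IHn; rewrite -(addn1 n) ap_add sumn_cat /= mulnDr IHn; nia.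
Qed.

(* Sum the multiples of d on both sides of the permutation. *)
Lemma count_dvdn_gaps d e beta delta G : 0 < d -> 0 < e -> coprime delta d ->
    d %| beta ->
    perm_eq ([seq g + e * d | g <- G] ++ iota 0 (e * d))
            (G ++ 0 :: ap beta delta 1 (e * d - 1)) ->
  count (fun g => d %| g) G * (2 * (e * d)) + e * d * (e - 1) =
  (e - 1) * (2 * beta + e * d * delta).
Proof.
move=> d_gt0 e_gt0 co db /(perm_filter (fun n => d %| n))/perm_sumn.
rewrite -size_filter; set a := e * d.
have -> : iota 0 a = 0 :: iota 1 (a - 1).
  by rewrite subn1 /a; case: (e * d) (muln_gt0 e d) => //; rewrite d_gt0 e_gt0.
rewrite !filter_cat /= dvdn0 !sumn_cat /= !filter_map.
rewrite (perm_sumn (perm_dvdn_iota _ _ d_gt0)).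
rewrite (@eq_filter _ _ (fun g => d %| g)); last first.
  by move=> g /=; rewrite dvdn_addl // dvdn_mull.
(* As [d] divides [beta] and is prime to [delta], exactly the indices [j * d] survive, leaving a
   progression of difference [d * delta]. *)
rewrite (@eq_filter _ (preim (fun i => beta + i * delta) _)
  (fun g => d %| g)); last first.
  by move=> i /=; rewrite dvdn_addr // Gauss_dvdl // coprime_sym.
rewrite (perm_sumn (perm_map _ (perm_dvdn_iota _ _ d_gt0))).
have -> : [seq beta + i * delta | i <- [seq j * d | j <- iota 1 (e - 1)]] =
    ap beta (d * delta) 1 (e - 1).
  by rewrite -map_comp; apply: eq_map => i /=; rewrite mulnA.
have -> : sumn [seq g + a | g <- [seq g <- G | d %| g]] =
    sumn [seq g <- G | d %| g] + size [seq g <- G | d %| g] * a.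
  by elim: [seq g <- G | d %| g] => //= x s ->; lia.
rewrite -[sumn [seq j * d | j <- _]]/(sumn (ap 0 d 1 (e - 1))).
have := sumn_ap 0 d (e - 1); have := sumn_ap beta (d * delta) (e - 1).
rewrite (_ : (e - 1).+1 = e); last by lia.
rewrite /a; nia.
Qed.

(** Up to full periods, the terms of index 1 to [d - 1] fill the nonzero classes; the term of index
    0, which is [beta], completes the period and so falls in class 0. *)
Lemma dvdn_ap_full d beta delta e : 0 < d -> 0 < e -> coprime delta d ->
    perm_eq (residues d (ap beta delta 1 (e * d - 1)))
            (residues d (iota 1 (e * d - 1))) ->
  d %| beta.
Proof.
move=> d_gt0 e_gt0 co.
rewrite (_ : e * d - 1 = d.-1 + (e - 1) * d); last first.
  by rewrite mulnBl mul1n; have : d <= e * d by [rewrite leq_pmull]; lia.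
rewrite -ap01 perm_residues_ap_shift ?coprime1n // ap01 => /perm_mem eqr.
have := uniq_residues_ap d beta delta 0 d co (leqnn d).
case: d d_gt0 eqr {co} => // d _ eqr; rewrite /= addn0 => /andP[bN _].
apply: contraNT bN => bN0.
rewrite -[X in _ \in X]/(residues d.+1 (ap beta delta 1 d)) eqr.
rewrite -modn_mod; apply: map_f; rewrite mem_iota lt0n bN0.
exact: ltn_pmod.
Qed.

(* With k = t - a, the first two equations read h b = (e - 1) k and
   h d b = (a - 1) k, so that (d - 1) k = 0. *)
Lemma multiples_count_eq0 a b d e t h : 0 < b -> 0 < a -> 1 < d ->
    a = e * d -> a <= t ->
    h * b + a * (e - 1) = (e - 1) * t ->
    h * d * b + a * (a - 1) = (a - 1) * t ->
  h = 0.
Proof.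
move=> b_gt0 a_gt0 d_gt1 aE /subnK <-; set k := t - a.
rewrite !mulnDr [a * (e - 1)]mulnC [a * (a - 1)]mulnC => /addIn hk /addIn hdk.
have : (e - 1) * d * k = (a - 1) * k by rewrite mulnAC -hk -hdk mulnAC.
have lt_ed : (e - 1) * d < a - 1.
  rewrite mulnBl -aE mul1n.
  have : d <= a by rewrite aE leq_pmull //; case: (e) aE a_gt0 => // ->.
  by clear -d_gt1; lia.
move/eqP; rewrite eqn_mul2r (ltn_eqF lt_ed) orbF => /eqP k0.
by move/eqP: hk; rewrite k0 muln0 muln_eq0 (gtn_eqF b_gt0) orbF => /eqP.
Qed.

(** For d = gcd([a], [m]) > 1, the sum identities for the divisors [d] and 1, together with |G| = d
    h, force [G] to be empty, where coprimality is assumed. *)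
Lemma balanced_gaps_coprime (a m beta delta : nat) (G : seq nat) :
    0 < a -> 0 < m -> 0 < delta -> (a = 2 -> beta = 0 /\ odd delta) ->
    (G = [::] -> coprime a m) ->
    perm_eq ([seq g + a | g <- G] ++ iota 0 a)
            (G ++ 0 :: ap beta delta 1 (a - 1)) ->
  balanced m G -> coprime a m.
Proof.
move=> a_gt0 m_gt0 delta_gt0 a2 G0 eqG balG.
pose d := gcdn a m; have d_gt0 : 0 < d by rewrite gcdn_gt0 a_gt0.
have [d_eq1|d_ne1] := eqVneq d 1; first by apply/eqP.
have dm : d %| m by apply: dvdn_gcdr.
have /dvdnP[e aE] : d %| a by apply: dvdn_gcdl.
have e_gt0 : 0 < e by case: (e) aE a_gt0 => // ->.
(* Translation by [a] is trivial modulo [d], so this agreement follows from [eqG] alone. *)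
have eqd : perm_eq (residues d (ap beta delta 1 (a - 1)))
                   (residues d (iota 1 (a - 1))).
  rewrite -(perm_residues_cancel d a G _ a_gt0 eqG).
  rewrite [X in perm_eq X _](_ : _ = residues d G) //.
  rewrite /residues -map_comp; apply: eq_map => g /=.
  by rewrite -modnDmr aE modnMl addn0.
have [co db] : coprime delta d /\ d %| beta.
  have [a_eq2|a_ne2] := eqVneq a 2.
    have [-> odd_delta] := a2 a_eq2; rewrite dvdn0.
    have d2 : d = 2.
      by apply/(prime_nt_dvdP _ d_ne1); rewrite // -a_eq2 dvdn_gcdl.
    by rewrite d2 coprimen2.
  have co : coprime delta d.
    apply: perm_residues_ap_coprime eqd => //; nia.
  by split=> //; apply: (dvdn_ap_full d beta delta e) => //; rewrite -aE.
have h_d := count_dvdn_balanced m d G m_gt0 dm balG.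
have w_d := count_dvdn_gaps d e beta delta G d_gt0 e_gt0 co db.
(* The divisor 1 turns the same identity into one for all gaps. *)
have w_1 := count_dvdn_gaps 1 a beta delta G isT a_gt0 (coprimen1 _) (dvd1n _).
rewrite muln1 -aE in w_d w_1; move: (w_d eqG) (w_1 eqG) => {}w_d {}w_1.
have size1 : count (fun g => 1 %| g) G = size G.
  by rewrite -count_predT; apply: eq_count => g; rewrite dvd1n.
rewrite size1 -h_d in w_1.
have d_gt1 : 1 < d by rewrite ltn_neqAle eq_sym d_ne1.
have le_at : a <= 2 * beta + a * delta.
  by rewrite (leq_trans (leq_pmulr _ delta_gt0)) // leq_addl.
have a2_gt0 : 0 < 2 * a by rewrite muln_gt0.
apply: G0; apply/nilP; rewrite /nilp -h_d.
by rewrite (multiples_count_eq0 _ _ _ _ _ _ a2_gt0 a_gt0 d_gt1 aE le_at w_d w_1).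
Qed.

Theorem theorem4p5 (S : set nat) (a m beta delta : nat)
    (hS : numerical_semigroup S) (haS : S a) (ha : a <> 0) (hm : 0 < m)
    (hdelta : 0 < delta)
    (hAp : apery S a =
       [set 0] `|` [set beta + i * delta | i in [set i | 1 <= i <= a - 1]])
    (ha1 : a = 1 -> beta = 0 /\ delta = 1)
    (ha2 : a = 2 -> beta = 0 /\ odd delta)
    (hN : gaps S = set0 -> coprime a m) :
  equidistributed_mod m (gaps S) <->
  gcdn (a * delta) m = 1 /\
  [\/ a = 1 %[mod m],
      a = 2 %[mod m] /\ beta + delta = 1 %[mod m],
      delta = 1 %[mod m] /\ beta = 0 %[mod m]
    | delta + 1 = 0 %[mod m] /\ beta = a %[mod m] ].
Proof.
have a_gt0 : 0 < a by case: a ha {haS hAp ha1 ha2 hN}.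
have [G uG GE] : exists2 G : seq nat, uniq G & gaps S = [set` G].
  have /finite_seqP[s ->] := numsg_finite_gaps hS.
  exists (undup s); first exact: undup_uniq.
  by apply/seteqP; split=> x /=; rewrite mem_undup.
have eqG := perm_gaps_apery S a beta delta G hS haS a_gt0 hdelta uG GE hAp.
(* Coprimality of [a] and [m] stays an argument: one direction gets it from [balanced_gaps_coprime],
   the other from the gcd condition. *)
have ap_equiv co := perm_residues_ap_iota m beta delta a a_gt0 hm co
  (fun h => proj2 (ha1 h)) (fun h => proj1 (ha2 h)).
have cancel := perm_residues_cancel m a G _ a_gt0 eqG.
rewrite GE equidistributed_mod_balanced //.
split=> [balG|[/eqP co_adm cases]].
  have co : coprime a m.
    (* Without gaps, equidistribution is vacuous and says nothing about [m]; [hN] covers that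
       case. *)
    apply: (balanced_gaps_coprime a m beta delta G) => // G0.
    by apply: hN; rewrite GE G0 set_nil.
  have := balanced_shift m a G hm balG; rewrite cancel.
  case/(ap_equiv co) => cod cases.
  by split=> //; apply/eqP; rewrite -/(coprime _ _) coprimeMl co.
have /andP[co cod] : coprime a m && coprime delta m by rewrite -coprimeMl.
by apply: (shift_balanced m a) => //; rewrite cancel; apply/(ap_equiv co).
Qed.
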